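(* $f(9,S_3)\le 126$.
   Context: $[n]=\{1,\dots,n\}$ and $\mathcal{P}(n)$ is the set of all subsets of $[n]$. $S_3$ (the claw) is the star with 3 edges. For a graph $G$, a hypergraph $H$ is called Berge-$G$ if there is a copy of $G$ with $V(G)\subseteq V(H)$ and a bijection $g:E(G)\to E(H)$ such that $e\subseteq g(e)$ for every $e\in E(G)$. A family of subsets of $[n]$ (viewed as a hypergraph with vertex set $[n]$) is $G$-free if it contains no subfamily that is a Berge-$G$ hypergraph. $f(n,G)$ denotes the smallest number of colors in a coloring (partition) of $\mathcal{P}(n)$ such that every color class is $G$-free. *)

(* Defs.v *)
From HB Require Import structures.
From mathcomp Require Import all_boot.

Set Implicit Arguments.
Unset Strict Implicit.
Unset Printing Implicit Defensive.

Record sgraph := SGraph {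
  vertex :> finType;
  adj : rel vertex;
  adj_sym : symmetric adj;
  adj_irrefl : irreflexive adj }.

Definition edges (G : sgraph) : {set {set G}} :=
  [set e : {set G} | [exists u, exists v, adj u v && (e == [set u; v])]].

Definition star_adj (k : nat) : rel 'I_k.+1 :=
  fun u v => (u == ord0) != (v == ord0).

Lemma star_adj_sym k : symmetric (@star_adj k).
Proof. by move=> u v; rewrite /star_adj eq_sym. Qed.

Lemma star_adj_irrefl k : irreflexive (@star_adj k).
Proof. by move=> u; rewrite /star_adj eqxx. Qed.

(* The star with k edges, centred at ord0. *)
Definition star (k : nat) : sgraph :=
  SGraph (@star_adj_sym k) (@star_adj_irrefl k).

(* The hypergraph on [n] (encoded as 'I_n) with edge set H is Berge-G.  The
   copy of G is given by the injection phi on vertices; g is total on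
   {set G}, but only its values on edges G are constrained. *)
Definition berge (G : sgraph) (n : nat) (H : {set {set 'I_n}}) : bool :=
  [exists phi : {ffun G -> 'I_n}, exists g : {ffun {set G} -> {set 'I_n}},
    [&& injectiveb phi,
        dinjectiveb g (mem (edges G)),
        g @: edges G == H
      & [forall e in edges G, phi @: e \subset g e]]].

Definition berge_free (G : sgraph) (n : nat) (F : {set {set 'I_n}}) : bool :=
  ~~ [exists H : {set {set 'I_n}}, (H \subset F) && berge G H].

Definition free_coloring (G : sgraph) (n : nat)
    (P : {set {set {set 'I_n}}}) : bool :=
  partition P [set: {set 'I_n}] && [forall F in P, berge_free G F].

Definition discrete_partition (n : nat) : {set {set {set 'I_n}}} :=
  [set [set A] | A : {set 'I_n}].

(* Smallest number of colors.  The discrete partition only seeds the search: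
   as G-freeness passes to subfamilies, it is a G-free coloring whenever some
   G-free coloring exists.  If none exists (which requires G to have at most
   one edge), the value is 2 ^ n by convention. *)
Definition f (n : nat) (G : sgraph) : nat :=
  #|[arg min_(P < discrete_partition n | free_coloring G P) #|P| ]|.

(* Main.v *)
Require Import Defs.
From mathcomp Require Import all_boot.

(** Call a member of a family usable at a vertex v if it properly contains
    {v}: only such a set can represent an edge of a claw centred at v.  A
    family is claw-free as soon as, at every v, it has at most two usable
    members, or its usable members at v lie within three points, which leaves
    no room for the centre and three leaves ([berge_free_star]).  Color classes
    may be replaced by families that merely cover the power set, because
    freeness passes to subfamilies ([f_le_size_cover]).  So it suffices to cover
    the subsets of a nine-point set by 126 families satisfying that criterion.

    Families with at most two usable members at every point do not suffice: the
    sizes of the sets with at least two points add up to 9 * 256 - 9 = 2295,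
    whereas in 126 such families they add up to at most 126 * 18 = 2268.  The second half of
    the criterion supplies what is missing.  In the affine plane AG(2,3), the
    three lines of a parallel class and the pairs inside them form a family of
    twelve sets covering each point three times, and it is claw-free because
    the usable sets at v lie within the line through v.  The four parallel
    classes use all 36 pairs and the 12 lines.

    The other families cover each point at most twice.
    - A pair {A, complement of A} covers each point once, so two such pairs
      form a family.  This handles everything outside a collection closed under
      complement, so the aim is to place the sets of size 7 and the complements
      of the lines, whose own complements are already used, in families of
      another kind.
    - The complements of the three lines of a parallel class cover each point
      twice: 4 families.
    - For disjoint pairs d, e of points, the complements of d and e together
      with d + e cover each point twice.  A pairing of the 36 pairs gives 18
      families, but spends 18 sets of size 4 whose complements remain.
    - Three of those complements, of d1 + e1, d2 + e2, d3 + e3, together with a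
      triple T, cover each point twice exactly when the graph with these six
      edges has degree 2 on T and degree 1 elsewhere.  So the edges of K_9 are
      decomposed into six such graphs: 6 families.
    - The six triples T are not lines and form two partitions of the points;
      the complements of the three triples of a partition cover each point
      twice: 2 families.
    The sets not placed form 184 complementary pairs (with 1, 9, 66 and 108
    smaller members of size 0, 1, 3 and 4), hence 92 families, and
    4 + 4 + 18 + 6 + 2 + 92 = 126.  That the families so described satisfy the
    criterion and cover the power set is checked by evaluation. *)

Set Implicit Arguments.
Unset Strict Implicit.
Unset Printing Implicit Defensive.

(** * Colorings from covers by free families *)

Lemma berge_free_sub (G : sgraph) (n : nat) (E F : {set {set 'I_n}}) :
  E \subset F -> berge_free G F -> berge_free G E.
Proof.
move=> sEF; apply: contra => /existsP[H /andP[sHE bH]].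
by apply/existsP; exists H; rewrite (subset_trans sHE sEF).
Qed.

Lemma discrete_partitionP n :
  partition (discrete_partition n) [set: {set 'I_n}].
Proof.
apply/and3P; split.
- rewrite eqEsubset subsetT; apply/subsetP => A _.
  by apply/bigcupP; exists [set A]; rewrite ?imset_f ?set11.
- apply/trivIsetP => _ _ /imsetP[A _ ->] /imsetP[B _ ->] neqAB.
  by rewrite disjoints1 inE; apply: contraNneq neqAB => ->.
- by apply/imsetP => -[A _] /setP/(_ A); rewrite !inE eqxx.
Qed.

(** Refining a free coloring to singletons keeps it free, so that the seed of
    the minimum defining [f] is itself a free coloring. *)
Lemma f_le_card (G : sgraph) (n : nat) (P : {set {set {set 'I_n}}}) :
  free_coloring G P -> f n G <= #|P|.
Proof.
move=> colP; rewrite /f; case: arg_minnP => [|Q _ minQ]; last exact: minQ.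
rewrite /free_coloring discrete_partitionP /=.
apply/forall_inP => _ /imsetP[A _ ->].
have [/and3P[/eqP covP _ _] /forall_inP freeP] := andP colP.
have /bigcupP[F PF AF] : A \in cover P by rewrite covP inE.
by apply: berge_free_sub (freeP F PF); rewrite sub1set.
Qed.

Lemma f_le_size_cover (G : sgraph) (n : nat) (Fs : seq {set {set 'I_n}}) :
    {in Fs, forall F, berge_free G F} ->
    (forall A, has (fun F : {set {set 'I_n}} => A \in F) Fs) ->
  f n G <= size Fs.
Proof.
move=> freeFs covFs.
(* Each set gets as color the index of the first family containing it. *)
pose color (A : {set 'I_n}) := find (fun F : {set {set 'I_n}} => A \in F) Fs.
have color_lt A : color A < size Fs by rewrite -has_find.
pose P := preim_partition color [set: {set 'I_n}].
have PE F : F \in P -> exists k : 'I_(size Fs), F = [set A | color A == k].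
  case/imsetP=> A _ ->; exists (Ordinal (color_lt A)).
  by apply/setP => B; rewrite !inE eq_sym.
apply: (@leq_trans #|P|).
  apply: f_le_card; rewrite /free_coloring preim_partitionP /=.
  apply/forall_inP => F /PE[k ->].
  apply: berge_free_sub (freeFs (nth set0 Fs k) (mem_nth _ (ltn_ord k))).
  apply/subsetP => A; rewrite inE => /eqP <-.
  exact: (nth_find set0 (covFs A)).
rewrite -[leqRHS]card_ord.
pose color_class (k : 'I_(size Fs)) := [set A | color A == k].
apply: leq_trans (leq_imset_card color_class _).
apply/subset_leq_card/subsetP => F /PE[k ->]; exact: imset_f.
Qed.

(** * A criterion for star-freeness *)

Definition usable (n : nat) (F : {set {set 'I_n}}) (v : 'I_n) :=
  [set A in F | [set v] \proper A].

(** The two trivial ways in which Hall's condition fails for the usable sets at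
    v: a star with k edges centred there needs k of them, and they have to
    contain its k + 1 vertices. *)
Lemma berge_free_star (k n : nat) (F : {set {set 'I_n}}) :
    0 < k ->
    (forall v, (#|usable F v| < k) || (#|cover (usable F v)| <= k)) ->
  berge_free (star k) F.
Proof.
move=> k_gt0 few; apply/existsP => -[H /andP[sHF]].
case/existsP=> phi /existsP[g].
case/and4P=> /injectiveP inj_phi /dinjectiveP inj_g /eqP gH /forall_inP sub_g.
pose v := phi ord0.
pose e (i : 'I_k) : {set star k} := [set ord0; lift ord0 i].
have edge_e i : e i \in edges (star k).
  rewrite inE; apply/existsP; exists ord0.
  by apply/existsP; exists (lift ord0 i); rewrite /= eqxx.
have vg i : v \in g (e i).
  by apply: (subsetP (sub_g _ (edge_e i))); rewrite imset_f ?set21.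
have leaf_g i : phi (lift ord0 i) \in g (e i).
  by apply: (subsetP (sub_g _ (edge_e i))); rewrite imset_f ?set22.
have usable_g i : g (e i) \in usable F v.
  rewrite inE (subsetP sHF) -?gH ?imset_f //=.
  apply/properP; split; first by rewrite sub1set.
  by exists (phi (lift ord0 i)); rewrite // inE (inj_eq inj_phi).
have inj_ge : injective (fun i => g (e i)).
  move=> i j /(inj_g _ _ (edge_e i) (edge_e j)) /setP/(_ (lift ord0 i)).
  by rewrite !inE eqxx /= (inj_eq lift_inj) => /esym/eqP.
have le_k : k <= #|usable F v|.
  rewrite -[leqLHS]card_ord -(card_imset _ inj_ge).
  by apply/subset_leq_card/subsetP => _ /imsetP[i _ ->].
have /orP[|] := few v; first by rewrite ltnNge le_k.
rewrite leqNgt => /negP; apply.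
rewrite -[leqLHS]card_ord -(card_codom inj_phi).
apply/subset_leq_card/subsetP => _ /codomP[u ->].
case: (unliftP ord0 u) => [i ->|->]; apply/bigcupP.
  by exists (g (e i)).
by exists (g (e (Ordinal k_gt0))).
Qed.

(** * Evaluating the criterion *)

(** Sets of points are represented by lists of naturals, on which membership
    and sizes can be evaluated. *)
Definition set_of (n : nat) (s : seq nat) : {set 'I_n} := [set i | val i \in s].

Definition family_of (n : nat) (C : seq (seq nat)) : {set {set 'I_n}} :=
  [set A | A \in [seq set_of n s | s <- C]].

Definition usable_seq (C : seq (seq nat)) (v : nat) :=
  [seq s <- C | (v \in s) && has (predC1 v) s].

Definition star_check (k n : nat) (C : seq (seq nat)) : bool :=
  all (fun v => (size (usable_seq C v) < k)
                || (size (undup (flatten (usable_seq C v))) <= k)) (iota 0 n).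

Lemma card_set_of_le n s : #|set_of n s| <= size (undup s).
Proof.
rewrite cardE -(size_map val); apply: uniq_leq_size.
  by rewrite (map_inj_uniq val_inj) enum_uniq.
by move=> _ /mapP[i + ->]; rewrite mem_enum inE mem_undup.
Qed.

Lemma usable_family_of n C (v : 'I_n) :
  {subset usable (family_of n C) v <= [seq set_of n s | s <- usable_seq C v]}.
Proof.
move=> A; rewrite !inE => /andP[/mapP[s sC ->] /properP[]].
rewrite sub1set inE => vs [i]; rewrite !inE => is_ neq_iv.
apply: map_f; rewrite mem_filter vs sC andbT /=.
by apply/hasP; exists (val i).
Qed.

Lemma star_checkP k n C :
  0 < k -> star_check k n C -> berge_free (star k) (family_of n C).
Proof.
move=> k_gt0 /allP chk; apply: berge_free_star => // v.
have v_in : val v \in iota 0 n by rewrite mem_iota ltn_ord.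
have /orP[lt_k|le_k] := chk _ v_in; apply/orP.
- left; apply: leq_ltn_trans lt_k; rewrite -(size_map (set_of n)) cardE.
  apply: uniq_leq_size (enum_uniq _) _ => A; rewrite mem_enum.
  exact: usable_family_of.
- right; apply: leq_trans le_k; apply: leq_trans (card_set_of_le n _).
  apply/subset_leq_card/subsetP => i /bigcupP[A /usable_family_of/mapP[s sC ->]].
  by rewrite !inE => is_; apply/flattenP; exists s.
Qed.

Fixpoint subseqs (s : seq nat) : seq (seq nat) :=
  if s is x :: s' then [seq x :: t | t <- subseqs s'] ++ subseqs s'
  else [:: [::]].

Lemma mem_subseqs s t : subseq t s -> t \in subseqs s.
Proof.
elim: s t => [|x s IHs] [|y t] //=; rewrite mem_cat.
  by rewrite (IHs [::]) ?sub0seq ?orbT.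
case: eqP => [->|_] /IHs ts; last by rewrite ts orbT.
by rewrite map_f.
Qed.

Lemma set_of_subseqs n (A : {set 'I_n}) :
  exists2 s, s \in subseqs (iota 0 n) & A = set_of n s.
Proof.
exists [seq i <- iota 0 n | i \in [seq val j | j in A]].
  by rewrite mem_subseqs ?filter_subseq.
apply/setP => i; rewrite inE mem_filter mem_iota /= ltn_ord andbT.
by rewrite mem_image //; apply: val_inj.
Qed.

Lemma f_star_le k n (Cs : seq (seq (seq nat))) :
    0 < k -> all (star_check k n) Cs ->
    all (mem (flatten Cs)) (subseqs (iota 0 n)) ->
  f n (star k) <= size Cs.
Proof.
move=> k_gt0 /allP chk /allP cov; rewrite -(size_map (family_of n)).
apply: f_le_size_cover => [_ /mapP[C /chk chkC ->]|A].
  exact: star_checkP.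
have [s /cov/flattenP[C CCs sC] ->] := set_of_subseqs A.
apply/hasP; exists (family_of n C); first exact: map_f.
by rewrite inE map_f.
Qed.

(** * The families *)

(** The point (x, y) of AG(2,3) is the number 3 * x + y. *)
Definition points := iota 0 9.

Definition compl (s : seq nat) := [seq p <- points | p \notin s].

Definition union (s t : seq nat) := [seq p <- points | p \in s ++ t].

(** Lines are the level sets of the linear forms x, y, x + y and 2 * x + y. *)
Definition parallel_classes : seq (seq (seq nat)) :=
  [seq [seq [seq p <- points | h p == c] | c <- iota 0 3]
     | h <- [:: fun p => p %/ 3; fun p => p %% 3; fun p => (p %/ 3 + p) %% 3;
                fun p => (2 * (p %/ 3) + p) %% 3]].

Definition line_family (ls : seq (seq nat)) :=
  [seq s <- subseqs points | (1 < size s) && has (subseq s) ls].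

(** A triple T with the six edges of a graph of degree 2 on T and degree 1
    elsewhere, grouped into three couples of disjoint edges. *)
Definition block := (seq nat * seq (seq nat * seq nat))%type.

(** The six blocks are the orbits of two under the translations
    (x, y) |-> (x, y + c).  The 12 pairs in these two represent all 12 orbits of
    pairs, so the six blocks decompose the edges of K_9; the 6 unions of couples
    represent distinct orbits of 4-sets, so no 4-set is used twice. *)
Definition base_blocks : seq block :=
  [:: ([:: 0; 3; 7], [:: ([:: 0; 1], [:: 2; 3]); ([:: 0; 3], [:: 4; 7]);
                         ([:: 5; 6], [:: 7; 8])]);
      ([:: 0; 3; 8], [:: ([:: 0; 5], [:: 1; 8]); ([:: 0; 6], [:: 3; 4]);
                         ([:: 2; 7], [:: 3; 8])])].

Definition translate (c : nat) (s : seq nat) : seq nat :=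
  [seq p <- points | p \in [seq 3 * (q %/ 3) + (q + c) %% 3 | q <- s]].

Definition translate_block (c : nat) (b : block) : block :=
  (translate c b.1, [seq (translate c q.1, translate c q.2) | q <- b.2]).

Definition block_families (b : block) : seq (seq (seq nat)) :=
  (b.1 :: [seq compl (union q.1 q.2) | q <- b.2])
    :: [seq [:: compl q.1; compl q.2; union q.1 q.2] | q <- b.2].

Definition orbit_families (b : block) : seq (seq (seq nat)) :=
  let bs := [seq translate_block c b | c <- iota 0 3] in
  [seq compl b'.1 | b' <- bs] :: flatten [seq block_families b' | b' <- bs].

Definition special_families : seq (seq (seq nat)) :=
  [seq line_family ls | ls <- parallel_classes]
    ++ [seq [seq compl l | l <- ls] | ls <- parallel_classes]
    ++ flatten [seq orbit_families b | b <- base_blocks].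

(** One member, the smaller, of each complementary pair that is left. *)
Definition leftover : seq (seq nat) :=
  let placed := flatten special_families in
  [seq s <- subseqs points | (size s <= 4) && (s \notin placed)].

Definition families : seq (seq (seq nat)) :=
  let rest := leftover in
  special_families
    ++ [seq [:: u.1; compl u.1; u.2; compl u.2]
          | u <- zip (take 92 rest) (drop 92 rest)].

Lemma size_families : size families = 126.
Proof. by vm_compute. Qed.

Lemma families_star_free : all (star_check 3 9) families.
Proof. by vm_compute. Qed.

Lemma families_cover : all (mem (flatten families)) (subseqs points).
Proof. by vm_compute. Qed.

Theorem proposition4 : f 9 (star 3) <= 126.
Proof.
have := @f_star_le 3 9 families isT families_star_free families_cover.
by rewrite size_families.
Qed.
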